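(* Let $q,a,b,h,t$ be complex numbers such that $|q^h|<1$, $|q^t|<1$ and $|q^{ht}|<1$, and suppose that none of the denominators below vanish. Then for all complex $w,z$ with $|w|<1$ and $|z|<1$, \[ \frac{(bw;q^t)_\infty}{(w;q^t)_\infty} \sum_{k=0}^{\infty} \frac{(a;q^h)_k}{(q^h;q^h)_k}\,\frac{(w;q^t)_{hk}}{(bw;q^t)_{hk}}\, z^k = \frac{(az;q^h)_\infty}{(z;q^h)_\infty} \sum_{j=0}^{\infty} \frac{(b;q^t)_j}{(q^t;q^t)_j}\,\frac{(z;q^h)_{tj}}{(az;q^h)_{tj}}\, w^j . \]
   Context: For complex $x$, $q^x$ denotes $\exp(x\log q)$ for a fixed choice of $\log q$. For a base $p$ with $|p|<1$: $(A;p)_\infty=\prod_{r=0}^\infty(1-Ap^r)$, and for any complex number $k$ (in particular non-integer $hk$ or $tj$) $(A;p)_k := (A;p)_\infty/(Ap^k;p)_\infty$, where $p^k=\exp(k\log p)$ with $\log p$ taken compatibly (e.g. $\log(q^h)=h\log q$); for nonnegative integers $k$ this equals $(1-A)(1-Ap)\cdots(1-Ap^{k-1})$, with $(A;p)_0=1$. *)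

(* Defs.v *)
(* Stdlib reals and Coquelicot's complex numbers. *)
From Stdlib Require Export Reals.
From Coquelicot Require Export Coquelicot.

Open Scope C_scope.

Definition Cexp (z : C) : C :=
  (exp (Re z) * cos (Im z), exp (Re z) * sin (Im z))%R.

(* q^x, where [logq] is the chosen logarithm of q. *)
Definition qpow (logq x : C) : C := Cexp (x * logq).

(* (A;p)_n for a natural number n. *)
Fixpoint qpoch (A p : C) (n : nat) : C :=
  match n with
  | O => 1
  | S m => qpoch A p m * (1 - A * p ^ m)
  end.

(* (A;p)_oo.  The limit exists whenever |p| < 1; [iota] is Coquelicot's
   definite description operator. *)
Definition qpoch_inf (A p : C) : C :=
  iota (T := C_CompleteNormedModule)
    (fun l : C => filterlim (qpoch A p) eventually (locally l)).

(* (A;p)_k = (A;p)_oo / (A p^k;p)_oo for a complex number k, where p is given by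
   its chosen logarithm [logp].  As / 0 = 0 in C, this is 0 whenever
   (A p^k;p)_oo = 0; so its being nonzero says that it is defined and does not
   vanish.  For k a natural number the quotient can degenerate to 0 / 0 (for
   instance when A = 1); [qpoch] is then the right value. *)
Definition qpochC (A logp k : C) : C :=
  qpoch_inf A (Cexp logp) / qpoch_inf (A * qpow logp k) (Cexp logp).

(* Main.v *)
(** By the q-binomial theorem, (bx;p)_oo / (x;p)_oo = sum_j (b;p)_j / (p;p)_j x^j for
    |p|, |x| < 1. Since the base q^t raised to the power hk is (q^{ht})^k, applying this
    with x = w q^{htk} to the k-th term of the left-hand side, and with x = z q^{htj} to
    the j-th term of the right-hand side, turns both sides into the iterated sums of one
    double series with terms
      (a;q^h)_k / (q^h;q^h)_k  (b;q^t)_j / (q^t;q^t)_j  z^k w^j q^{htjk},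
    which is absolutely convergent because |q^{ht}| < 1.

    The q-binomial theorem follows from (1 - x) f(x) = (1 - bx) f(px) for the sum f of the
    series: iterating gives (x;p)_n f(x) = (bx;p)_n f(p^n x), and f(p^n x) tends to 1. *)

From Stdlib Require Import Lra Lia.
Require Import Defs.

(** * Limits of complex sequences *)

(** Stating convergence through the real sequence of moduli makes the real limit lemmas and squeeze
    arguments available; [Clim_filterlim] links it back to the filter formulation. *)
Definition Clim (u : nat -> C) (l : C) : Prop :=
  is_lim_seq (fun n => Cmod (u n - l)) 0%R.

Lemma Clim_filterlim (u : nat -> C) (l : C) :
  Clim u l <-> filterlim u eventually (locally (T := C_NormedModule) l).
Proof.
  unfold Clim; rewrite <- is_lim_seq_spec.
  rewrite (filterlim_locally_ball_norm (U := C_NormedModule)).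
  split; intros H eps; destruct (H eps) as [N HN]; exists N; intros n Hn;
    specialize (HN n Hn).
  - rewrite Rminus_0_r, Rabs_pos_eq in HN by apply Cmod_ge_0; exact HN.
  - rewrite Rminus_0_r, Rabs_pos_eq by apply Cmod_ge_0; exact HN.
Qed.

Lemma Clim_unique (u : nat -> C) (l m : C) : Clim u l -> Clim u m -> l = m.
Proof.
  intros Hl Hm.
  apply Clim_filterlim in Hl; apply Clim_filterlim in Hm.
  exact (@filterlim_locally_unique nat C_AbsRing C_NormedModule eventually _ u l m Hl Hm).
Qed.

Lemma Clim_ext_loc (u v : nat -> C) (l : C) :
  eventually (fun n => u n = v n) -> Clim u l -> Clim v l.
Proof.
  intros [N HN]; apply is_lim_seq_ext_loc; exists N; intros n Hn; now rewrite HN.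
Qed.

Lemma Clim_ext (u v : nat -> C) (l : C) :
  (forall n, u n = v n) -> Clim u l -> Clim v l.
Proof. intros E; apply Clim_ext_loc; exists O; auto. Qed.

Lemma Clim_le (u : nat -> C) (l : C) (b : nat -> R) :
  (forall n, (Cmod (u n - l) <= b n)%R) -> is_lim_seq b 0%R -> Clim u l.
Proof.
  intros Hb H0.
  apply is_lim_seq_le_le with (u := fun _ => 0%R) (w := b).
  - intros n; split; [apply Cmod_ge_0 | apply Hb].
  - apply is_lim_seq_const.
  - exact H0.
Qed.

Lemma Clim_const (c : C) : Clim (fun _ => c) c.
Proof.
  apply is_lim_seq_ext with (fun _ => 0%R); [| apply is_lim_seq_const].
  intros _; replace (c - c) with (RtoC 0) by ring; now rewrite Cmod_0.
Qed.

Lemma Clim_plus (u v : nat -> C) (l m : C) :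
  Clim u l -> Clim v m -> Clim (fun n => u n + v n) (l + m).
Proof.
  intros Hu Hv.
  apply Clim_le with (fun n => Cmod (u n - l) + Cmod (v n - m))%R.
  - intros n; replace (u n + v n - (l + m)) with ((u n - l) + (v n - m)) by ring.
    apply Cmod_triangle.
  - replace 0%R with (0 + 0)%R by ring.
    now apply is_lim_seq_plus'.
Qed.

Lemma Clim_mult (u v : nat -> C) (l m : C) :
  Clim u l -> Clim v m -> Clim (fun n => u n * v n) (l * m).
Proof.
  intros Hu Hv.
  apply Clim_le with (fun n => Cmod (u n - l) * Cmod (v n - m)
    + (Cmod (u n - l) * Cmod m + Cmod l * Cmod (v n - m)))%R.
  - intros n.
    replace (u n * v n - l * m)
      with ((u n - l) * (v n - m) + ((u n - l) * m + l * (v n - m))) by ring.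
    eapply Rle_trans; [apply Cmod_triangle |].
    rewrite <- !Cmod_mult.
    apply Rplus_le_compat_l, Cmod_triangle.
  - replace 0%R with (0 * 0 + (0 * Cmod m + Cmod l * 0))%R by ring.
    repeat apply is_lim_seq_plus'; apply is_lim_seq_mult';
      (exact Hu || exact Hv || apply is_lim_seq_const).
Qed.

Lemma Clim_opp (u : nat -> C) (l : C) : Clim u l -> Clim (fun n => - u n) (- l).
Proof.
  apply is_lim_seq_ext; intros n.
  rewrite <- Cmod_opp; f_equal; ring.
Qed.

Lemma Clim_minus (u v : nat -> C) (l m : C) :
  Clim u l -> Clim v m -> Clim (fun n => u n - v n) (l - m).
Proof. intros Hu Hv; apply Clim_plus; [exact Hu | now apply Clim_opp]. Qed.

Lemma Cmod_triangle_inv (x y : C) : (Rabs (Cmod x - Cmod y) <= Cmod (x - y))%R.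
Proof.
  assert (H1 := Cmod_triangle (x - y) y).
  assert (H2 := Cmod_triangle (y - x) x).
  replace (x - y + y) with x in H1 by ring.
  replace (y - x + x) with y in H2 by ring.
  replace (y - x) with (- (x - y)) in H2 by ring; rewrite Cmod_opp in H2.
  apply Rabs_le; lra.
Qed.

Lemma Clim_Cmod (u : nat -> C) (l : C) :
  Clim u l -> is_lim_seq (fun n => Cmod (u n)) (Cmod l).
Proof.
  intros Hu; apply is_lim_seq_spec; intros eps.
  apply is_lim_seq_spec in Hu; destruct (Hu eps) as [N HN]; exists N; intros n Hn.
  specialize (HN n Hn); rewrite Rminus_0_r, Rabs_pos_eq in HN by apply Cmod_ge_0.
  eapply Rle_lt_trans; [apply Cmod_triangle_inv | exact HN].
Qed.

Lemma Clim_neq_0 (u : nat -> C) (l : C) :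
  l <> 0 -> Clim u l -> eventually (fun n => u n <> 0).
Proof.
  intros Hl Hu; apply Cmod_gt_0 in Hl.
  assert (HM := Clim_Cmod u l Hu).
  apply is_lim_seq_spec in HM; destruct (HM (mkposreal _ Hl)) as [N HN].
  exists N; intros n Hn E; specialize (HN n Hn); simpl in HN.
  rewrite E, Cmod_0, Rabs_left in HN; lra.
Qed.

Lemma Clim_inv (u : nat -> C) (l : C) :
  l <> 0 -> Clim u l -> Clim (fun n => / u n) (/ l).
Proof.
  intros Hl Hu.
  assert (Hl' : (0 < Cmod l)%R) by now apply Cmod_gt_0.
  assert (HM := Clim_Cmod u l Hu).
  (* The identity |1/u - 1/l| = |u - l| / (|u| |l|) holds only once [u n] is nonzero, that is,
     eventually. *)
  apply is_lim_seq_ext_loc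
    with (fun n => Cmod (u n - l) * / (Cmod (u n) * Cmod l))%R.
  - destruct (Clim_neq_0 u l Hl Hu) as [N HN]; exists N; intros n Hn.
    specialize (HN n Hn).
    rewrite <- Cmod_mult, <- Cmod_inv, <- Cmod_mult by now apply Cmult_neq_0.
    rewrite <- Cmod_opp; f_equal; field; auto.
  - replace 0%R with (0 * / (Cmod l * Cmod l))%R by ring.
    apply is_lim_seq_mult'; [exact Hu |].
    apply (is_lim_seq_inv _ (Finite (Cmod l * Cmod l))).
    + apply is_lim_seq_mult'; [exact HM | apply is_lim_seq_const].
    + intros E; injection E; nra.
Qed.

Lemma Clim_pow (p : C) : (Cmod p < 1)%R -> Clim (fun n => p ^ n) 0.
Proof.
  intros Hp; apply is_lim_seq_ext with (fun n => Cmod p ^ n)%R.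
  - intros n; rewrite <- Cmod_pow; f_equal; ring.
  - apply is_lim_seq_geom; rewrite Rabs_pos_eq; [exact Hp | apply Cmod_ge_0].
Qed.

(** * Complex series and their comparison with real series *)

Notation is_Cseries := (is_series (V := C_NormedModule)).

Lemma is_Cseries_Clim (u : nat -> C) (l : C) :
  is_Cseries u l <-> Clim (sum_n (G := C_AbelianMonoid) u) l.
Proof. symmetry; apply Clim_filterlim. Qed.

Lemma is_Cseries_unique (u : nat -> C) (l m : C) :
  is_Cseries u l -> is_Cseries u m -> l = m.
Proof. rewrite !is_Cseries_Clim; apply Clim_unique. Qed.

Lemma is_Cseries_ext (u v : nat -> C) (l : C) :
  (forall n, u n = v n) -> is_Cseries u l -> is_Cseries v l.
Proof. apply (is_series_ext (V := C_NormedModule)). Qed.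

Lemma is_Cseries_scal (c : C) (u : nat -> C) (l : C) :
  is_Cseries u l -> is_Cseries (fun n => c * u n) (c * l).
Proof. apply (is_series_scal_l (V := C_NormedModule) c u l). Qed.

Lemma is_Cseries_minus (u v : nat -> C) (l m : C) :
  is_Cseries u l -> is_Cseries v m -> is_Cseries (fun n => u n - v n) (l - m).
Proof. apply (is_series_minus (V := C_NormedModule) u v l m). Qed.

Lemma is_Cseries_shift (u : nat -> C) (l : C) :
  is_Cseries u l -> is_Cseries (fun n => u (S n)) (l - u O).
Proof.
  intros H; apply (is_series_incr_1 (V := C_NormedModule) u).
  change (is_Cseries u (l - u O + u O)).
  now replace (l - u O + u O) with l by ring.
Qed.

Lemma is_Cseries_abs (u : nat -> C) (b : nat -> R) :
  (forall n, (Cmod (u n) <= b n)%R) -> ex_series b -> exists l, is_Cseries u l.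
Proof. apply (ex_series_le (V := C_CompleteNormedModule)). Qed.

Lemma Cmod_sum_n_le (u : nat -> C) (b : nat -> R) (N : nat) :
  (forall n, (n <= N)%nat -> (Cmod (u n) <= b n)%R) ->
  (Cmod (sum_n (G := C_AbelianMonoid) u N) <= sum_n b N)%R.
Proof.
  induction N as [|N IH]; intros H.
  - rewrite !sum_O; now apply H.
  - rewrite !sum_Sn; eapply Rle_trans; [apply Cmod_triangle |].
    apply Rplus_le_compat; [apply IH; intros; apply H; lia | apply H; lia].
Qed.

Lemma Cmod_series_le (u : nat -> C) (b : nat -> R) (l : C) :
  (forall n, (Cmod (u n) <= b n)%R) -> is_Cseries u l -> ex_series b ->
  (Cmod l <= Series b)%R.
Proof.
  intros Hb Hu Hs.
  apply (is_lim_seq_le (fun N => Cmod (sum_n (G := C_AbelianMonoid) u N)) (sum_n b)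
           (Cmod l) (Series b)).
  - intros N; apply Cmod_sum_n_le; auto.
  - apply Clim_Cmod, is_Cseries_Clim, Hu.
  - apply (Series_correct b Hs).
Qed.

(** Both remainders are sums of the series shifted by [S N], so this is [Cmod_series_le] applied to
    the shifted series. *)
Lemma Cmod_series_tail_le (u : nat -> C) (b : nat -> R) (l : C) (N : nat) :
  (forall n, (Cmod (u n) <= b n)%R) -> is_Cseries u l -> ex_series b ->
  (Cmod (l - sum_n (G := C_AbelianMonoid) u N) <= Series b - sum_n b N)%R.
Proof.
  intros Hb Hu Hs.
  assert (Ht : is_series (fun k => b (S N + k)%nat) (Series b - sum_n b N)%R).
  { apply is_series_incr_n; [lia |].
    change (is_series b (Series b - sum_n b N + sum_n b N)%R).
    replace (Series b - sum_n b N + sum_n b N)%R with (Series b) by ring.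
    now apply Series_correct. }
  rewrite <- (is_series_unique _ _ Ht).
  apply Cmod_series_le with (fun k => u (S N + k)%nat).
  - intros n; apply Hb.
  - apply (is_series_incr_n (V := C_NormedModule)); [lia |].
    simpl Nat.pred; change (is_Cseries u
      (l - sum_n (G := C_AbelianMonoid) u N + sum_n (G := C_AbelianMonoid) u N)).
    now match goal with |- is_Cseries u ?x => replace x with l by ring end.
  - eexists; exact Ht.
Qed.

(** Ratio test with a bound that need only hold from [N] on: the tail is dominated by the geometric
    series [u N * r ^ k]. *)
Lemma ex_series_ratio (u : nat -> R) (r : R) (N : nat) :
  (forall n, 0 <= u n)%R -> (0 <= r < 1)%R ->
  (forall n, (N <= n)%nat -> (u (S n) <= r * u n)%R) -> ex_series u.
Proof.
  intros H0 Hr H.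
  apply (ex_series_incr_n u N).
  apply (ex_series_le (V := R_CompleteNormedModule)) with (fun k => u N * r ^ k)%R.
  - intros k; change (norm (u (N + k)%nat)) with (Rabs (u (N + k)%nat)).
    rewrite Rabs_pos_eq by apply H0.
    induction k as [|k IH].
    + rewrite Nat.add_0_r; simpl; lra.
    + rewrite Nat.add_succ_r.
      eapply Rle_trans; [apply H; lia |].
      simpl; replace (u N * (r * r ^ k))%R with (r * (u N * r ^ k))%R by ring.
      now apply Rmult_le_compat_l.
  - apply (ex_series_scal_l (V := R_NormedModule)), ex_series_geom.
    rewrite Rabs_pos_eq; lra.
Qed.

(** * Exchange of summation in a dominated double series *)

Lemma sum_n_Cminus (u v : nat -> C) (N : nat) :
  sum_n (G := C_AbelianMonoid) (fun n => u n - v n) N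
    = sum_n (G := C_AbelianMonoid) u N - sum_n (G := C_AbelianMonoid) v N.
Proof.
  induction N as [|N IH].
  - now rewrite !sum_O.
  - rewrite !sum_Sn, IH.
    generalize (sum_n (G := C_AbelianMonoid) u N) (sum_n (G := C_AbelianMonoid) v N).
    intros x y.
    change (x - y + (u (S N) - v (S N)) = x + u (S N) - (y + v (S N)) :> C); ring.
Qed.

(** Cutting row j at [N] costs at most [A j] times the tail of B. Summed over the first rows, the
    total error is at most a partial sum of A times that tail, which tends to 0. *)
Lemma double_partial_sum (u : nat -> nat -> C) (A B : nat -> R) (r : nat -> C) :
  ex_series A -> ex_series B -> (forall j k, (Cmod (u j k) <= A j * B k)%R) ->
  (forall j, 0 <= A j)%R -> (forall j, is_Cseries (u j) (r j)) ->
  Clim (fun N => sum_n (G := C_AbelianMonoid) r N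
    - sum_n (G := C_AbelianMonoid)
        (fun j => sum_n (G := C_AbelianMonoid) (u j) N) N) 0.
Proof.
  intros HA HB Hu A0 Hr.
  apply Clim_le with (fun N => sum_n A N * (Series B - sum_n B N))%R.
  - intros N.
    assert (E : forall x : C, x - 0 = x) by (intros; ring).
    rewrite E, <- sum_n_Cminus.
    eapply Rle_trans;
      [apply (Cmod_sum_n_le _ (fun j => A j * (Series B - sum_n B N))%R) |].
    + intros j _.
      replace (A j * (Series B - sum_n B N))%R
        with (Series (fun k => A j * B k) - sum_n (fun k => A j * B k) N)%R.
      * apply Cmod_series_tail_le; auto.
        now apply (ex_series_scal_l (V := R_NormedModule)).
      * rewrite Series_scal_l.
        replace (sum_n (fun k => A j * B k)%R N) with (A j * sum_n B N)%R; [ring |].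
        symmetry; apply (sum_n_mult_l (K := R_Ring)).
    + right; apply (sum_n_mult_r (K := R_Ring)).
  - replace 0%R with (Series A * (Series B - Series B))%R by ring.
    apply is_lim_seq_mult'; [apply (Series_correct A HA) |].
    apply is_lim_seq_minus'; [apply is_lim_seq_const | apply (Series_correct B HB)].
Qed.

(** Row sums and column sums are both compared with the sums over the squares j, k <= N, and these
    do not depend on the order of summation. Convergence of the row sums comes from the bound
    [A j * Series B]. *)
Lemma double_series_exchange (u : nat -> nat -> C) (A B : nat -> R) (r c : nat -> C) :
  ex_series A -> ex_series B -> (forall j k, (Cmod (u j k) <= A j * B k)%R) ->
  (forall j, 0 <= A j)%R -> (forall k, 0 <= B k)%R ->
  (forall j, is_Cseries (u j) (r j)) ->
  (forall k, is_Cseries (fun j => u j k) (c k)) ->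
  exists l, is_Cseries r l /\ is_Cseries c l.
Proof.
  intros HA HB Hu A0 B0 Hr Hc.
  assert (Dr := double_partial_sum u A B r HA HB Hu A0 Hr).
  assert (Hu' : forall k j, (Cmod (u j k) <= B k * A j)%R).
  { intros k j; rewrite Rmult_comm; apply Hu. }
  assert (Dc := double_partial_sum (fun k j => u j k) B A c HB HA Hu' B0 Hc).
  destruct (is_Cseries_abs r (fun j => scal (Series B) (A j))) as [l Hl].
  - intros j; change (Cmod (r j) <= Series B * A j)%R.
    rewrite Rmult_comm, <- Series_scal_l.
    apply Cmod_series_le with (u j); auto.
    now apply (ex_series_scal_l (V := R_NormedModule)).
  - now apply (ex_series_scal_l (V := R_NormedModule)).
  - exists l; split; [exact Hl |].
    apply is_Cseries_Clim; apply is_Cseries_Clim in Hl.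
    (* The partial sum of [c] is that of [r], minus the error of the rows against the square, plus
       the error of the columns against it; both errors tend to 0. *)
    replace l with (l - 0 + 0) by ring.
    refine (Clim_ext _ _ _ _ (Clim_plus _ _ _ _ (Clim_minus _ _ _ _ Hl Dr) Dc)).
    intros N; simpl.
    rewrite (sum_n_switch (G := C_AbelianMonoid) u N N); ring.
Qed.

(** * Non-vanishing of the finite products *)

Lemma one_minus_neq_0 (x : C) : (Cmod x < 1)%R -> 1 - x <> 0.
Proof.
  intros Hx E.
  replace x with (RtoC 1) in Hx.
  - rewrite Cmod_1 in Hx; lra.
  - replace (RtoC 1) with (1 - x + x) by ring; rewrite E; ring.
Qed.

Lemma Cmod_mult_lt_1 (x y : C) :
  (Cmod x < 1)%R -> (Cmod y <= 1)%R -> (Cmod (x * y) < 1)%R.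
Proof.
  intros Hx Hy; rewrite Cmod_mult.
  assert (H1 := Cmod_ge_0 x); assert (H2 := Cmod_ge_0 y); nra.
Qed.

Lemma Cmod_pow_le_1 (p : C) (n : nat) : (Cmod p < 1)%R -> (Cmod (p ^ n) <= 1)%R.
Proof.
  intros Hp; rewrite Cmod_pow, <- (pow1 n).
  apply pow_incr; split; [apply Cmod_ge_0 | lra].
Qed.

Lemma one_minus_pow_neq_0 (x p : C) (n : nat) :
  (Cmod x < 1)%R -> (Cmod p < 1)%R -> 1 - x * p ^ n <> 0.
Proof. intros Hx Hp; now apply one_minus_neq_0, Cmod_mult_lt_1, Cmod_pow_le_1. Qed.

Lemma qpoch_neq_0 (x p : C) (n : nat) :
  (Cmod x < 1)%R -> (Cmod p < 1)%R -> qpoch x p n <> 0.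
Proof.
  intros Hx Hp; induction n as [|n IH]; simpl.
  - apply C1_nz.
  - apply Cmult_neq_0; [exact IH |].
    now apply one_minus_pow_neq_0.
Qed.

Lemma qpoch_0 (p : C) (n : nat) : qpoch 0 p n = 1.
Proof. induction n as [|n IH]; simpl; [| rewrite IH]; ring. Qed.

(** * The q-binomial series and its functional equation *)

Definition qbin_term (b p x : C) (n : nat) : C :=
  qpoch b p n / qpoch p p n * x ^ n.

Lemma qbin_term_S (b p x : C) (n : nat) : (Cmod p < 1)%R ->
  qbin_term b p x (S n) = (1 - b * p ^ n) / (1 - p * p ^ n) * x * qbin_term b p x n.
Proof.
  intros Hp; unfold qbin_term; simpl.
  field; auto using qpoch_neq_0, one_minus_pow_neq_0.
Qed.

(** Since p^n tends to 0, the ratio of consecutive terms tends to [x], and the ratio test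
    applies. *)
Lemma qbin_term_summable (b p x : C) : (Cmod p < 1)%R -> (Cmod x < 1)%R ->
  ex_series (fun n => Cmod (qbin_term b p x n)).
Proof.
  intros Hp Hx.
  assert (L : is_lim_seq
    (fun n => Cmod ((1 - b * p ^ n) / (1 - p * p ^ n) * x)) (Cmod x)).
  { apply Clim_Cmod.
    assert (E : 1 - p * 0 = 1) by ring.
    refine (eq_ind ((1 - b * 0) * / (1 - p * 0) * x) (Clim _) _ x _);
      [| rewrite E; field; apply C1_nz].
    apply Clim_mult; [apply Clim_mult | apply Clim_const].
    - apply Clim_minus; [apply Clim_const |].
      apply Clim_mult; [apply Clim_const | now apply Clim_pow].
    - apply (Clim_inv (fun n => 1 - p * p ^ n)).
      + rewrite E; apply C1_nz.
      + apply Clim_minus; [apply Clim_const |].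
        apply Clim_mult; [apply Clim_const | now apply Clim_pow]. }
  (* With half the gap between |x| and 1 as tolerance, the ratios eventually stay below (1 + |x|) /
     2 < 1. *)
  assert (He : (0 < (1 - Cmod x) / 2)%R) by lra.
  apply is_lim_seq_spec in L; destruct (L (mkposreal _ He)) as [N HN]; simpl in HN.
  assert (Hx0 := Cmod_ge_0 x).
  apply (ex_series_ratio _ ((1 + Cmod x) / 2) N).
  - intros n; apply Cmod_ge_0.
  - lra.
  - intros n Hn; rewrite qbin_term_S, Cmod_mult by exact Hp.
    apply Rmult_le_compat_r; [apply Cmod_ge_0 |].
    specialize (HN n Hn); apply Rabs_lt_between in HN; lra.
Qed.

Definition qbin_sum (b p x : C) : C :=
  iota (T := C_CompleteNormedModule) (fun l : C => is_Cseries (qbin_term b p x) l).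

Lemma qbin_sum_correct (b p x : C) : (Cmod p < 1)%R -> (Cmod x < 1)%R ->
  is_Cseries (qbin_term b p x) (qbin_sum b p x).
Proof.
  intros Hp Hx.
  destruct (is_Cseries_abs (qbin_term b p x) _ (fun n => Rle_refl _)
    (qbin_term_summable b p x Hp Hx)) as [l Hl].
  unfold qbin_sum.
  rewrite (iota_unique (V := C_CompleteNormedModule) _ l); [exact Hl | | exact Hl].
  intros m Hm; exact (is_Cseries_unique _ _ _ Hm Hl).
Qed.

(** With c_n the coefficient of x^n, the relation c_{n+1} (1 - p^{n+1}) = c_n (1 - b p^n) sums to
    f(x) - f(px) = x (f(x) - b f(px)), a rearrangement of the claim. *)
Lemma qbin_sum_step (b p x : C) : (Cmod p < 1)%R -> (Cmod x < 1)%R ->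
  (1 - x) * qbin_sum b p x = (1 - b * x) * qbin_sum b p (x * p).
Proof.
  intros Hp Hx.
  assert (H1 := qbin_sum_correct b p x Hp Hx).
  assert (H2 : is_Cseries (qbin_term b p (x * p)) (qbin_sum b p (x * p))).
  { apply qbin_sum_correct; [exact Hp |].
    apply Cmod_mult_lt_1; [exact Hx | lra]. }
  assert (E1 := is_Cseries_shift _ _ (is_Cseries_minus _ _ _ _ H1 H2)).
  assert (E2 := is_Cseries_scal x _ _
    (is_Cseries_minus _ _ _ _ H1 (is_Cseries_scal b _ _ H2))).
  (* The subtracted 0 is the difference of the two zeroth terms, both equal to 1, which the index
     shift removes. *)
  assert (E : qbin_sum b p x - qbin_sum b p (x * p) - 0
              = x * (qbin_sum b p x - b * qbin_sum b p (x * p))).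
  { apply (is_Cseries_unique (fun n =>
      qbin_term b p x (S n) - qbin_term b p (x * p) (S n))).
    - replace (RtoC 0) with (qbin_term b p x 0 - qbin_term b p (x * p) 0); [exact E1 |].
      unfold qbin_term; simpl; ring.
    - revert E2; apply is_Cseries_ext; intros n; cbv beta.
      unfold qbin_term; rewrite !Cpow_mult_l; simpl.
      field; auto using qpoch_neq_0, one_minus_pow_neq_0. }
  replace ((1 - x) * qbin_sum b p x) with (qbin_sum b p x - qbin_sum b p (x * p) - 0
    + qbin_sum b p (x * p) - x * qbin_sum b p x) by ring.
  rewrite E; ring.
Qed.

Lemma qbin_sum_iter (b p x : C) (n : nat) : (Cmod p < 1)%R -> (Cmod x < 1)%R ->
  qpoch x p n * qbin_sum b p x = qpoch (b * x) p n * qbin_sum b p (x * p ^ n).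
Proof.
  intros Hp Hx; induction n as [|n IH]; simpl.
  - f_equal; f_equal; ring.
  - assert (H := qbin_sum_step b p (x * p ^ n) Hp
      (Cmod_mult_lt_1 _ _ Hx (Cmod_pow_le_1 p n Hp))).
    replace (x * (p * p ^ n)) with (x * p ^ n * p) by ring.
    transitivity ((1 - x * p ^ n) * (qpoch x p n * qbin_sum b p x)); [ring |].
    rewrite IH.
    transitivity (qpoch (b * x) p n * ((1 - x * p ^ n) * qbin_sum b p (x * p ^ n)));
      [ring |].
    rewrite H; ring.
Qed.

(** The zeroth term is 1, and every later term carries a factor s^{n+1} of modulus at most |s|. The
    remaining series does not depend on [s], so the bound is uniform along s = p^n. *)
Lemma qbin_sum_near_0 (b p x s : C) :
  (Cmod p < 1)%R -> (Cmod x < 1)%R -> (Cmod s <= 1)%R ->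
  (Cmod (qbin_sum b p (x * s) - 1)
     <= Cmod s * Series (fun n => Cmod (qbin_term b p x (S n))))%R.
Proof.
  intros Hp Hx Hs.
  assert (H := is_Cseries_shift _ _ (qbin_sum_correct b p (x * s) Hp
    (Cmod_mult_lt_1 _ _ Hx Hs))).
  assert (Hsum : ex_series (fun n => Cmod (qbin_term b p x (S n)))).
  { apply (ex_series_incr_1 (fun n => Cmod (qbin_term b p x n))).
    now apply qbin_term_summable. }
  replace (qbin_term b p (x * s) 0) with (RtoC 1) in H
    by (unfold qbin_term; simpl; field; apply C1_nz).
  rewrite <- Series_scal_l.
  refine (Cmod_series_le _ _ _ _ H _).
  - intros n; unfold qbin_term.
    rewrite Cpow_mult_l, Cmult_assoc, Cmod_mult, Rmult_comm.
    apply Rmult_le_compat_r; [apply Cmod_ge_0 |].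
    rewrite Cpow_S, Cmod_mult, Cmod_pow.
    rewrite <- (Rmult_1_r (Cmod s)) at 3.
    apply Rmult_le_compat_l; [apply Cmod_ge_0 |].
    rewrite <- (pow1 n); apply pow_incr; split; [apply Cmod_ge_0 | exact Hs].
  - now apply (ex_series_scal_l (V := R_NormedModule)).
Qed.

(** * Infinite products and the q-binomial theorem *)

Lemma Clim_qbin_sum (b p x : C) : (Cmod p < 1)%R -> (Cmod x < 1)%R ->
  Clim (fun n => qbin_sum b p (x * p ^ n)) 1.
Proof.
  intros Hp Hx.
  apply Clim_le with
    (fun n => Cmod p ^ n * Series (fun n => Cmod (qbin_term b p x (S n))))%R.
  - intros n; rewrite <- Cmod_pow.
    apply qbin_sum_near_0; [exact Hp | exact Hx | now apply Cmod_pow_le_1].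
  - match goal with |- is_lim_seq (fun n => _ * ?M)%R _ =>
      replace 0%R with (0 * M)%R by ring end.
    apply is_lim_seq_mult'; [| apply is_lim_seq_const].
    apply is_lim_seq_geom; rewrite Rabs_pos_eq; [exact Hp | apply Cmod_ge_0].
Qed.

(* At [b = 0] the recursion reads (x;p)_n * qbin_sum 0 p x = qbin_sum 0 p (x p^n),
   which tends to 1: this gives both the convergence and the non-vanishing of (x;p)_oo. *)
Lemma Clim_qpoch_mult (p x : C) : (Cmod p < 1)%R -> (Cmod x < 1)%R ->
  Clim (fun n => qpoch x p n * qbin_sum 0 p x) 1.
Proof.
  intros Hp Hx; refine (Clim_ext _ _ _ _ (Clim_qbin_sum 0 p x Hp Hx)).
  intros n; rewrite qbin_sum_iter by assumption.
  replace (0 * x) with (RtoC 0) by ring; rewrite qpoch_0; ring.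
Qed.

(** If it vanished, the zero sequence would converge to 1. *)
Lemma qbin_sum_0_neq_0 (p x : C) : (Cmod p < 1)%R -> (Cmod x < 1)%R ->
  qbin_sum 0 p x <> 0.
Proof.
  intros Hp Hx E; assert (H := Clim_qpoch_mult p x Hp Hx); rewrite E in H.
  apply C1_nz, (Clim_unique _ _ _ H).
  refine (Clim_ext _ _ _ _ (Clim_const 0)); intros n; ring.
Qed.

Lemma qpoch_inf_eq (A p l : C) : Clim (qpoch A p) l -> qpoch_inf A p = l.
Proof.
  intros H; apply (iota_unique (V := C_CompleteNormedModule)).
  - intros m Hm; apply Clim_filterlim in Hm; exact (Clim_unique _ _ _ Hm H).
  - now apply Clim_filterlim.
Qed.

(** This is Euler's identity: the series at b = 0 sums to 1/(x;p)_oo. *)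
Lemma Clim_qpoch (p x : C) : (Cmod p < 1)%R -> (Cmod x < 1)%R ->
  Clim (qpoch x p) (/ qbin_sum 0 p x).
Proof.
  intros Hp Hx; assert (H0 := qbin_sum_0_neq_0 p x Hp Hx).
  replace (/ qbin_sum 0 p x) with (1 * / qbin_sum 0 p x) by ring.
  refine (Clim_ext _ _ _ _
    (Clim_mult _ _ _ _ (Clim_qpoch_mult p x Hp Hx) (Clim_const _))).
  intros n; field; exact H0.
Qed.

Lemma qpoch_inf_neq_0 (p x : C) : (Cmod p < 1)%R -> (Cmod x < 1)%R ->
  qpoch_inf x p <> 0.
Proof.
  intros Hp Hx; rewrite (qpoch_inf_eq _ _ _ (Clim_qpoch p x Hp Hx)).
  intros E; apply C1_nz.
  rewrite <- (Cinv_r _ (qbin_sum_0_neq_0 p x Hp Hx)), E; ring.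
Qed.

Lemma q_binomial (b p x : C) : (Cmod p < 1)%R -> (Cmod x < 1)%R ->
  qbin_sum b p x = qpoch_inf (b * x) p / qpoch_inf x p.
Proof.
  intros Hp Hx; assert (H0 := qbin_sum_0_neq_0 p x Hp Hx).
  assert (H1 := Clim_qbin_sum b p x Hp Hx).
  (* Since |bx| may be 1 or more, [Clim_qpoch] cannot be applied to [b * x]. The limit comes instead
     from dividing the iterated recursion by f(x p^n), which tends to 1 and is therefore eventually
     nonzero. *)
  assert (L : Clim (qpoch (b * x) p) (/ qbin_sum 0 p x * qbin_sum b p x * / 1)).
  { refine (Clim_ext_loc _ _ _ _ (Clim_mult _ _ _ _
      (Clim_mult _ _ _ _ (Clim_qpoch p x Hp Hx) (Clim_const (qbin_sum b p x)))
      (Clim_inv _ _ C1_nz H1))).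
    destruct (Clim_neq_0 _ _ C1_nz H1) as [N HN]; exists N; intros n Hn.
    rewrite qbin_sum_iter by assumption; field; now apply HN. }
  rewrite (qpoch_inf_eq _ _ _ L), (qpoch_inf_eq _ _ _ (Clim_qpoch p x Hp Hx)).
  field; auto using C1_nz.
Qed.

(** * Complex exponents *)

Lemma Cexp_plus (x y : C) : Cexp (x + y) = Cexp x * Cexp y.
Proof.
  unfold Cexp, Cplus, Cmult, Re, Im; simpl.
  rewrite exp_plus, cos_plus, sin_plus; f_equal; ring.
Qed.

Lemma Cexp_INR_mult (x : C) (n : nat) : Cexp (INR n * x) = Cexp x ^ n.
Proof.
  induction n as [|n IH].
  - simpl; replace (0 * x) with (RtoC 0) by ring.
    unfold Cexp; simpl; rewrite exp_0, cos_0, sin_0.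
    unfold RtoC; f_equal; ring.
  - rewrite S_INR, RtoC_plus, Cpow_S, <- IH, <- Cexp_plus; f_equal; ring.
Qed.

Lemma qpow_mult_INR (logq h t : C) (k : nat) :
  qpow (t * logq) (h * INR k) = qpow logq (h * t) ^ k.
Proof. unfold qpow; rewrite <- Cexp_INR_mult; f_equal; ring. Qed.

Lemma qpochC_neq_0 (A logp k : C) : qpochC A logp k <> 0 ->
  qpoch_inf A (Cexp logp) <> 0 /\ qpoch_inf (A * qpow logp k) (Cexp logp) <> 0.
Proof.
  unfold qpochC; intros H; split; intros E; apply H; rewrite E.
  - unfold Cdiv; ring.
  (* Both coordinates of the complex inverse of 0 have numerator 0, so they vanish whatever value
     the real inverse of 0 takes. *)
  - unfold Cdiv, Cinv, RtoC, Cmult, Rdiv; simpl; f_equal; ring.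
Qed.

(** The quotient of the two shifted infinite products is a q-binomial sum at x p^k. What remains in
    front is independent of [k], so it can be pulled out of a sum over k. *)
Lemma qpochC_ratio (b x logp k : C) :
  (Cmod (Cexp logp) < 1)%R -> (Cmod x < 1)%R -> (Cmod (qpow logp k) <= 1)%R ->
  qpochC (b * x) logp k <> 0 ->
  qpochC x logp k / qpochC (b * x) logp k =
  qpoch_inf x (Cexp logp) / qpoch_inf (b * x) (Cexp logp)
    * qbin_sum b (Cexp logp) (x * qpow logp k).
Proof.
  intros Hp Hx Hk HD; destruct (qpochC_neq_0 _ _ _ HD) as [H1 H2].
  assert (Hxk := Cmod_mult_lt_1 _ _ Hx Hk).
  assert (H3 := qpoch_inf_neq_0 _ _ Hp Hxk).
  rewrite q_binomial by assumption; unfold qpochC.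
  rewrite Cmult_assoc; field; auto.
Qed.

(** * The double series and the transformation formula *)

(** The factor s^{kj} has modulus at most 1, so the double series is dominated by the product of two
    absolutely convergent q-binomial series. Writing s^{kj} as (s^k)^j or (s^j)^k turns each inner
    sum into a q-binomial sum. *)
Lemma qbin_double_sum (a b p r s w z : C) :
  (Cmod p < 1)%R -> (Cmod r < 1)%R -> (Cmod s < 1)%R ->
  (Cmod w < 1)%R -> (Cmod z < 1)%R ->
  exists l, is_Cseries (fun k => qbin_term a r z k * qbin_sum b p (w * s ^ k)) l /\
            is_Cseries (fun j => qbin_term b p w j * qbin_sum a r (z * s ^ j)) l.
Proof.
  intros Hp Hr Hs Hw Hz.
  apply double_series_exchange with
    (u := fun k j => qbin_term a r z k * qbin_term b p w j * s ^ (k * j))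
    (A := fun k => Cmod (qbin_term a r z k)) (B := fun j => Cmod (qbin_term b p w j)).
  - now apply qbin_term_summable.
  - now apply qbin_term_summable.
  - intros k j; rewrite <- Cmod_mult, (Cmod_mult _ (s ^ _)).
    rewrite <- (Rmult_1_r (Cmod (qbin_term a r z k * _))) at 2.
    apply Rmult_le_compat_l; [apply Cmod_ge_0 | now apply Cmod_pow_le_1].
  - intros k; apply Cmod_ge_0.
  - intros j; apply Cmod_ge_0.
  - intros k.
    refine (is_Cseries_ext _ _ _ _ (is_Cseries_scal _ _ _
      (qbin_sum_correct b p (w * s ^ k) Hp (Cmod_mult_lt_1 _ _ Hw (Cmod_pow_le_1 s k Hs))))).
    intros j; unfold qbin_term; rewrite Cpow_mult_l, Cpow_mult_r; ring.
  - intros j.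
    refine (is_Cseries_ext _ _ _ _ (is_Cseries_scal _ _ _
      (qbin_sum_correct a r (z * s ^ j) Hr (Cmod_mult_lt_1 _ _ Hz (Cmod_pow_le_1 s j Hs))))).
    intros k; unfold qbin_term; rewrite Cpow_mult_l, Nat.mul_comm, Cpow_mult_r; ring.
Qed.

Theorem theorem1 (q logq a b h t w z : C)
  (Hlogq : Cexp logq = q)
  (Hh : (Cmod (qpow logq h) < 1)%R)
  (Ht : (Cmod (qpow logq t) < 1)%R)
  (Hht : (Cmod (qpow logq (h * t)) < 1)%R)
  (Hw : (Cmod w < 1)%R)
  (Hz : (Cmod z < 1)%R)
  (* none of the denominators vanish *)
  (Dw : qpoch_inf w (qpow logq t) <> 0)
  (Dz : qpoch_inf z (qpow logq h) <> 0)
  (Dqh : forall k : nat, qpoch (qpow logq h) (qpow logq h) k <> 0)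
  (Dqt : forall j : nat, qpoch (qpow logq t) (qpow logq t) j <> 0)
  (Dbw : forall k : nat, qpochC (b * w) (t * logq) (h * INR k) <> 0)
  (Daz : forall j : nat, qpochC (a * z) (h * logq) (t * INR j) <> 0) :
  exists S T : C,
    is_series (V := C_NormedModule)
      (fun k : nat =>
         qpoch a (qpow logq h) k / qpoch (qpow logq h) (qpow logq h) k *
         (qpochC w (t * logq) (h * INR k) /
          qpochC (b * w) (t * logq) (h * INR k)) * z ^ k) S /\
    is_series (V := C_NormedModule)
      (fun j : nat =>
         qpoch b (qpow logq t) j / qpoch (qpow logq t) (qpow logq t) j *
         (qpochC z (h * logq) (t * INR j) /
          qpochC (a * z) (h * logq) (t * INR j)) * w ^ j) T /\
    qpoch_inf (b * w) (qpow logq t) / qpoch_inf w (qpow logq t) * S =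
    qpoch_inf (a * z) (qpow logq h) / qpoch_inf z (qpow logq h) * T.
Proof.
  (* The hypotheses at index 0 already give that (bw;q^t)_oo and (az;q^h)_oo are nonzero. *)
  destruct (qpochC_neq_0 _ _ _ (Dbw O)) as [Hbw _].
  destruct (qpochC_neq_0 _ _ _ (Daz O)) as [Haz _].
  change (Cexp (t * logq)) with (qpow logq t) in Hbw.
  change (Cexp (h * logq)) with (qpow logq h) in Haz.
  destruct (qbin_double_sum a b (qpow logq t) (qpow logq h) (qpow logq (h * t)) w z)
    as [l [HS HT]]; try assumption.
  (* Each witness is the common double sum [l] times the constant from [qpochC_ratio], the inverse
     of the prefactor in the claim; both sides therefore reduce to [l]. *)
  exists (qpoch_inf w (qpow logq t) / qpoch_inf (b * w) (qpow logq t) * l).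
  exists (qpoch_inf z (qpow logq h) / qpoch_inf (a * z) (qpow logq h) * l).
  split; [| split].
  - refine (is_Cseries_ext _ _ _ _ (is_Cseries_scal _ _ _ HS)); intros k.
    assert (E := qpow_mult_INR logq h t k).
    rewrite qpochC_ratio; [| exact Ht | exact Hw | | apply Dbw].
    + rewrite E; unfold qbin_term; change (Cexp (t * logq)) with (qpow logq t); ring.
    + rewrite E; now apply Cmod_pow_le_1.
  - refine (is_Cseries_ext _ _ _ _ (is_Cseries_scal _ _ _ HT)); intros j.
    assert (E := qpow_mult_INR logq t h j); rewrite (Cmult_comm t h) in E.
    rewrite qpochC_ratio; [| exact Hh | exact Hz | | apply Daz].
    + rewrite E; unfold qbin_term; change (Cexp (h * logq)) with (qpow logq h); ring.
    + rewrite E; now apply Cmod_pow_le_1.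
  - field; auto.
Qed.
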